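(* Let $n>5$ and let $S\in\mathcal D_n^s$ be such that one of its directed cycles has even length and the other has odd length. Then: (i) if $n$ is odd, the maximal energy among such $S$ is attained by $S\cong D_n^s[2,n-2]$ (a positive $2$-cycle and a positive $(n-2)$-cycle); (ii) the minimal energy among such $S$ is attained by $S\cong D_n^s[\boldsymbol 2,3]$ (a negative $2$-cycle and a positive $3$-cycle).
   Context: A signed digraph (sidigraph) is a digraph in which every arc carries a sign $+1$ or $-1$; its adjacency matrix $A(S)=[a_{ij}]$ has $a_{ij}$ equal to the sign of the arc $w_iw_j$ if it exists and $0$ otherwise. If $\rho_1,\dots,\rho_n$ are the eigenvalues of $A(S)$, the energy of $S$ is $E(S)=\sum_{k=1}^n|\mathrm{Re}(\rho_k)|$. The sign of a directed cycle is the product of the signs of its arcs. For $k\ge 2$, $C_k$ denotes a directed cycle of length $k$ with sign $+1$ and $\boldsymbol{C}_k$ a directed cycle of length $k$ with sign $-1$. It is known that $E(C_k)=2\cot\frac{\pi}{k}$ if $k\equiv0\pmod 4$, $2\csc\frac{\pi}{k}$ if $k\equiv 2\pmod 4$, $\csc\frac{\pi}{2k}$ if $k$ is odd; and $E(\boldsymbol C_k)=2\csc\frac{\pi}{k}$ if $k\equiv0\pmod 4$, $2\cot\frac{\pi}{k}$ if $k\equiv 2\pmod 4$, $\csc\frac{\pi}{2k}$ if $k$ is odd. $\mathcal D_n^s$ is the class of sidigraphs on $n$ vertices whose underlying graph is connected and which contain exactly two directed cycles, these two cycles being vertex-disjoint. The energy of $S\in\mathcal D_n^s$ equals the sum of the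 energies of its two directed cycles. For integers $p,q\ge 2$ with $p+q\le n$, $D_n^s[p,q]$ and $D_n^s[\boldsymbol p,q]$ denote members of $\mathcal D_n^s$ whose two directed cycles are $C_p,C_q$, respectively $\boldsymbol C_p, C_q$. *)

(* Defs.v *)
From HB Require Import structures.
From mathcomp Require Import all_boot all_order all_algebra all_field.
Set Implicit Arguments. Unset Strict Implicit. Unset Printing Implicit Defensive.
Import Order.TTheory GRing.Theory Num.Theory.
Local Open Scope ring_scope.

(* A sidigraph on the vertex set 'I_n is given by its adjacency matrix
   A : 'M[int]_n with entries in {-1,0,1}; A i j <> 0 iff there is an arc
   w_i w_j, whose sign is A i j.  No loops (zero diagonal). *)
Definition sidigraph (n : nat) (A : 'M[int]_n) : Prop :=
  (forall i j, A i j \in [:: -1; 0; 1]) /\ (forall i, A i i = 0).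

Definition underlying_connected (n : nat) (A : 'M[int]_n) : Prop :=
  forall u v : 'I_n, connect (fun x y => (A x y != 0) || (A y x != 0)) u v.

Definition cycle_arcs (n : nat) (s : seq 'I_n) : {set 'I_n * 'I_n} :=
  [set p | p \in zip s (rot 1 s)].

Definition is_dcycle (n : nat) (A : 'M[int]_n) (C : {set 'I_n * 'I_n}) : Prop :=
  exists s : seq 'I_n,
    [/\ (1 < size s)%N, uniq s, C = cycle_arcs s &
        forall p, p \in C -> A p.1 p.2 != 0].

Definition cycle_verts (n : nat) (C : {set 'I_n * 'I_n}) : {set 'I_n} :=
  [set p.1 | p in C].

Definition cycle_len (n : nat) (C : {set 'I_n * 'I_n}) : nat := #|C|.

Definition cycle_sign (n : nat) (A : 'M[int]_n) (C : {set 'I_n * 'I_n}) : int :=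
  \prod_(p in C) A p.1 p.2.

Definition exactly_two_cycles (n : nat) (A : 'M[int]_n)
    (C1 C2 : {set 'I_n * 'I_n}) : Prop :=
  [/\ C1 != C2, is_dcycle A C1, is_dcycle A C2,
      [disjoint cycle_verts C1 & cycle_verts C2] &
      forall C, is_dcycle A C -> C = C1 \/ C = C2].

Definition in_Dns (n : nat) (A : 'M[int]_n) : Prop :=
  [/\ sidigraph A, underlying_connected A &
      exists C1 C2, exactly_two_cycles A C1 C2].

Definition Dns_with (n : nat) (A : 'M[int]_n) (p : nat) (sp : int)
    (q : nat) (sq : int) : Prop :=
  in_Dns A /\ exists C1 C2, [/\ exactly_two_cycles A C1 C2,
     cycle_len C1 = p, cycle_sign A C1 = sp,
     cycle_len C2 = q & cycle_sign A C2 = sq].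

Definition Dns_even_odd (n : nat) (A : 'M[int]_n) : Prop :=
  in_Dns A /\ exists C1 C2, [/\ exactly_two_cycles A C1 C2,
     ~~ odd (cycle_len C1) & odd (cycle_len C2)].

(* Eigenvalues (with multiplicity) of A, as the roots in algC of the
   characteristic polynomial. *)
Definition eigenvalues (n : nat) (A : 'M[int]_n) : seq algC :=
  sval (closed_field_poly_normal (char_poly (map_mx (fun z : int => z%:~R) A))).

Definition energy (n : nat) (A : 'M[int]_n) : algC :=
  \sum_(z <- eigenvalues A) `|'Re z|.

(* Main.v *)
(* The characteristic polynomial of A(S) is X^(n-p-q) (X^p - s) (X^q - t), where p, q and s, t are the lengths and signs of the two cycles: in the Leibniz expansion of det(X - A), a permutation contributes only if each of its nontrivial orbits is a directed cycle of S, so only four permutations survive.  The energy is therefore the sum of |Re z| over the roots of X^p - s and X^q - t.  These sums are compared by transporting them along an embedding of the algebraic numbers into R[i], where the roots are explicit.  The Dirichlet kernel gives csc(pi/2q) for odd q and at most 2 csc(pi/p) for even p, and the bounds 1/x <= csc x <= 1/x + x/5 finish the comparison. *)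
From Stdlib Require Import Reals Lra.

(** * Inequalities for the cosecant *)

Section Cosecant.
Local Open Scope R_scope.

Lemma inv_sin_antimono (x y : R) : 0 < x -> x <= y -> y <= PI / 2 -> / sin y <= / sin x.
Proof.
intros x0 xy yp; pose proof PI_RGT_0 as hpi.
apply Rinv_le_contravar; [apply sin_gt_0; lra|].
apply sin_incr_1; lra.
Qed.

(** The Taylor bound [x - x ^ 3 / 6 <= sin x] suffices, since [(/ x + x / 5) * (x - x ^ 3 / 6) = 1 +
    x ^ 2 * (1 - x ^ 2) / 30] is at least 1 on the unit interval. *)
Lemma inv_sin_le (x : R) : 0 < x -> x <= 1 -> / sin x <= / x + x / 5.
Proof.
intros x0 x1.
assert (hs : x - x ^ 3 / 6 <= sin x).
{ assert (xp : 0 <= x <= PI) by (pose proof PI2_3_2; lra).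
  destruct (sin_bound x 0 (proj1 xp) (proj2 xp)) as [h _].
  replace (x - x ^ 3 / 6) with (sin_approx x (2 * 0 + 1)); [exact h|].
  unfold sin_approx, sin_term; simpl; field. }
assert (hx : 0 < x - x ^ 3 / 6) by nra.
apply Rle_trans with (/ (x - x ^ 3 / 6)); [now apply Rinv_le_contravar|].
apply (Rmult_le_reg_r (x - x ^ 3 / 6)); [exact hx|].
rewrite Rinv_l by lra.
replace ((/ x + x / 5) * (x - x ^ 3 / 6)) with (1 + x ^ 2 * (1 - x ^ 2) / 30) by (field; lra).
assert (0 <= x ^ 2 * (1 - x ^ 2)) by (apply Rmult_le_pos; nra).
lra.
Qed.

Lemma inv_sin_ge (x : R) : 0 < x -> x < PI -> / x <= / sin x.
Proof.
intros x0 xp; apply Rinv_le_contravar; [now apply sin_gt_0|].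
apply Rlt_le, sin_lt_x; exact x0.
Qed.

(* The remainder [1 / sin x - 1 / x] is at most [x / 5], hence the two cycles on the left gain at most [2 PI / 15] over [2 (p + q) / PI], while the 2-cycle on the right gains [2 - 4 / PI]. *)
Lemma inv_sin_trade (p q : R) : 4 <= p -> 3 <= q ->
  2 * / sin (PI / p) + / sin (PI / (2 * q)) <= 2 + / sin (PI / (2 * (p + q - 2))).
Proof.
intros hp hq.
assert (h3 : 3 < PI) by (pose proof PI2_3_2; lra).
pose proof PI_4 as h4.
(* Here [PI / r <= 1] because [PI <= 4 <= r]; the bound is used at [r = p] and at
   [r = 2 * q >= 6]. *)
assert (bound : forall r, 4 <= r -> / sin (PI / r) <= r / PI + PI / (5 * r)).
{ intros r hr.
  replace (r / PI + PI / (5 * r)) with (/ (PI / r) + PI / r / 5) by (field; lra).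
  apply inv_sin_le; [apply Rdiv_lt_0_compat; lra|].
  apply (Rmult_le_reg_r r); [lra|]; unfold Rdiv; rewrite Rmult_assoc, Rinv_l; lra. }
assert (b1 := bound p hp).
assert (b2 : / sin (PI / (2 * q)) <= 2 * q / PI + PI / (5 * (2 * q))) by (apply bound; lra).
assert (b3 : / (PI / (2 * (p + q - 2))) <= / sin (PI / (2 * (p + q - 2)))).
{ apply inv_sin_ge; [apply Rdiv_lt_0_compat; lra|].
  apply (Rmult_lt_reg_r (2 * (p + q - 2))); [lra|]; unfold Rdiv; rewrite Rmult_assoc, Rinv_l; nra. }
replace (/ (PI / (2 * (p + q - 2)))) with (2 * (p / PI) + 2 * q / PI - 4 * / PI) in b3 by (field; lra).
assert (b4 : PI / (5 * p) <= PI / 20).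
{ apply Rmult_le_compat_l; [lra|]; apply Rinv_le_contravar; lra. }
assert (b5 : PI / (5 * (2 * q)) <= PI / 30).
{ apply Rmult_le_compat_l; [lra|]; apply Rinv_le_contravar; lra. }
(* What remains is [2 PI / 15 <= 2 - 4 / PI]; with [3 < PI <= 4] the left side is at most 8/15 and
   the right side at least 2/3. *)
assert (b6 : / PI <= / 3) by (apply Rinv_le_contravar; lra).
lra.
Qed.

Lemma inv_sin_div_mono (a b : R) : 1 <= a -> a <= b ->
  / sin (PI / (2 * a)) <= / sin (PI / (2 * b)).
Proof.
intros ha hab; pose proof PI_RGT_0 as hpi.
apply inv_sin_antimono; [apply Rdiv_lt_0_compat; lra| |].
- apply Rmult_le_compat_l; [lra|]; apply Rinv_le_contravar; lra.
- apply Rmult_le_compat_l; [lra|]; apply Rinv_le_contravar; lra.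
Qed.

End Cosecant.

From HB Require Import structures.
Require Import Defs.
From mathcomp Require Import all_boot all_order all_fingroup all_algebra all_field.
From mathcomp Require Import classical_sets reals Rstruct complex ring lra zify.
Set Implicit Arguments. Unset Strict Implicit. Unset Printing Implicit Defensive.
Import Order.TTheory GRing.Theory Num.Theory.
Local Open Scope ring_scope.

(** * Directed cycles as cyclic permutations *)

(** Turns the pairing of [s] with [rot 1 s] into the graph of [next s], so that a directed cycle can
    be handled as a function on its vertices. *)
Lemma map_next (T : eqType) (s : seq T) : uniq s -> map (next s) s = rot 1 s.
Proof.
case: s => // a s us; rewrite rot1_cons.
apply: (@eq_from_nth _ a) => [|i]; first by rewrite size_rcons size_map.
rewrite size_map => ilt; rewrite (nth_map a) // next_nth mem_nth // index_uniq //.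
by rewrite nth_rcons; move: ilt; rewrite /= ltnS leq_eqVlt => /predU1P[->|->] //; rewrite ltnn eqxx nth_default.
Qed.

Lemma cycle_arcsE (n : nat) (s : seq 'I_n) : uniq s ->
  cycle_arcs s = [set (i, next s i) | i in s].
Proof.
move=> us; apply/setP => p; rewrite inE -map_next // -[X in zip X]map_id zip_map.
by apply/mapP/imsetP => -[x xs ->]; exists x.
Qed.

Lemma mem_cycle_arcs (n : nat) (s : seq 'I_n) (i j : 'I_n) : uniq s ->
  ((i, j) \in cycle_arcs s) = (i \in s) && (j == next s i).
Proof.
move=> us; rewrite cycle_arcsE //; apply/imsetP/andP => [[x xs [-> ->]]|[xs /eqP->]] //.
by exists i.
Qed.

Lemma cycle_verts_arcs (n : nat) (s : seq 'I_n) : uniq s ->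
  cycle_verts (cycle_arcs s) = [set i in s].
Proof.
move=> us; rewrite cycle_arcsE // /cycle_verts -imset_comp; apply/setP => i.
by rewrite inE; apply/imsetP/idP => [[x xs ->]|xs] //; exists i.
Qed.

Lemma next_arc_inj (n : nat) (s : seq 'I_n) : injective (fun i : 'I_n => (i, next s i)).
Proof. by move=> i j []. Qed.

Lemma cycle_len_arcs (n : nat) (s : seq 'I_n) : uniq s -> cycle_len (cycle_arcs s) = size s.
Proof.
move=> us; rewrite /cycle_len cycle_arcsE // card_imset; last exact: next_arc_inj.
exact/card_uniqP.
Qed.

Lemma cycle_sign_arcs (n : nat) (A : 'M[int]_n) (s : seq 'I_n) : uniq s ->
  cycle_sign A (cycle_arcs s) = \prod_(i in s) A i (next s i).
Proof.
move=> us; rewrite /cycle_sign cycle_arcsE // big_imset //=.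
by move=> i j _ _; apply: next_arc_inj.
Qed.

Lemma next_neq (T : eqType) (s : seq T) (i : T) :
  uniq s -> (1 < size s)%N -> i \in s -> next s i != i.
Proof.
move=> us s1 /rot_to[k t st]; rewrite -(next_rot k us) st.
have ut : uniq (i :: t) by rewrite -st rot_uniq.
have : (1 < size (i :: t))%N by rewrite -st size_rot.
case: t ut {st} => //= j t; rewrite eqxx inE negb_or -!andbA => /andP[ij _] _.
by rewrite eq_sym.
Qed.

(** * Cyclic permutations and their parity *)

Definition cycle_perm (T : finType) (s : seq T) (us : uniq s) : {perm T} :=
  perm (can_inj (prev_next us)).

Lemma cycle_permE (T : finType) (s : seq T) (us : uniq s) (i : T) :
  cycle_perm us i = next s i.
Proof. by rewrite permE. Qed.

Lemma next_notin (T : eqType) (s : seq T) (i : T) : i \notin s -> next s i = i.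
Proof. by move=> h; rewrite next_nth (negbTE h). Qed.

(** The transposition acts last: it redirects to [x] the vertex that preceded [y], and sends [x],
    fixed by the shorter cycle, to [y]. Each added vertex thus flips the parity. *)
Lemma cycle_perm_cons (T : finType) (x y : T) (s : seq T)
    (uxys : uniq [:: x, y & s]) (uys : uniq (y :: s)) :
  cycle_perm uxys = (cycle_perm uys * tperm x y)%g.
Proof.
have [xys ys] : x \notin y :: s /\ y \notin s by move: uxys => /=; case/and3P.
apply/permP => i; rewrite permM !cycle_permE.
have [->|ix] := eqVneq i x; first by rewrite (next_notin xys) tpermL /= eqxx.
have [iys|iys] := boolP (i \in y :: s); last first.
  rewrite (next_notin iys) next_notin; last by rewrite in_cons negb_or ix.
  rewrite tpermD // 1?eq_sym //.
  by apply: contraNneq iys => ->; rewrite inE eqxx.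
rewrite !next_nth iys inE (negbTE ix) iys /= [x == i]eq_sym (negbTE ix) /=.
set k := (if y == i then _ else _).
(* [k] is the index of [i] in [y :: s]. Past the end of [s], [i] is the last vertex and both lookups
   return their default, [x] for the long cycle and [y] for the short one. *)
have [ks|ks] := ltnP k (size s); last by rewrite !nth_default // tpermR.
rewrite (set_nth_default x y) // tpermD //.
  by apply: contraNneq xys => ->; rewrite inE mem_nth // orbT.
by apply: contraNneq ys => ->; rewrite mem_nth.
Qed.

Lemma odd_cycle_perm (T : finType) (s : seq T) (us : uniq s) : (0 < size s)%N ->
  odd_perm (cycle_perm us) = ~~ odd (size s).
Proof.
elim: s us => // x [|y s] IH uxys _.
  rewrite /= (_ : cycle_perm _ = 1%g) ?odd_perm1 //.
  by apply/permP => i; rewrite cycle_permE perm1 /=; case: eqVneq.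
have uys : uniq (y :: s) by case/andP: uxys.
have xy : x != y by move: uxys; rewrite /= inE negb_or -!andbA => /andP[].
by rewrite (cycle_perm_cons uxys uys) odd_permM odd_tperm xy IH // addbT.
Qed.

(** * The characteristic polynomial *)

(** Stated for any injective [f], since it serves both the permutations of the Leibniz expansion and
    the successor map of the extremal examples. *)
Lemma is_dcycle_orbit (n : nat) (A : 'M[int]_n) (f : 'I_n -> 'I_n) (i : 'I_n) :
  injective f -> (forall j, f j != j -> A j (f j) != 0) -> f i != i ->
  is_dcycle A (cycle_arcs (fingraph.orbit f i)).
Proof.
move=> finj fA fi; have uo := orbit_uniq f i; have co := cycle_orbit finj i.
have io := in_orbit f i.
have fio : f i \in fingraph.orbit f i by rewrite -fconnect_orbit fconnect1.
exists (fingraph.orbit f i); split=> //.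
  case: (fingraph.orbit f i) io fio => [|a [|b t]] //.
  by rewrite !inE => /eqP ia /eqP fa; rewrite fa ia eqxx in fi.
case=> j k; rewrite mem_cycle_arcs // => /andP[jo /eqP-> /=].
(* If [f] fixed [j], cancelling the injective iterate that leads from [i] to [j] would make [f] fix
   [i]. *)
rewrite (nextE co jo); apply: fA; apply: contraNneq fi => fj.
have mj : iter (findex f i j) f i = j by rewrite iter_findex // fconnect_orbit.
have iinj : injective (iter (findex f i j) f) by move: (findex f i j); elim=> // m IH x y /finj/IH.
by apply/eqP/iinj; rewrite -iterSr /= mj.
Qed.

Section TwoCycles.
Variables (n : nat) (A : 'M[int]_n) (s1 s2 : seq 'I_n).
Hypotheses (us1 : uniq s1) (us2 : uniq s2).
Hypotheses (len1 : (1 < size s1)%N) (len2 : (1 < size s2)%N).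
Hypothesis s12 : forall i, i \in s1 -> i \notin s2.
Hypothesis A_diag : forall i, A i i = 0.
Hypothesis A_dcycle : forall C, is_dcycle A C -> C = cycle_arcs s1 \/ C = cycle_arcs s2.

(** Each boolean tells whether the corresponding cycle is run through or left pointwise fixed; these
    are the four permutations that can contribute to the determinant. *)
Definition sub_cycle_perm (b : bool * bool) : 'S_n :=
  ((if b.1 then cycle_perm us1 else 1) * (if b.2 then cycle_perm us2 else 1))%g.

Lemma sub_cycle_permE b i : sub_cycle_perm b i =
  if i \in s1 then (if b.1 then next s1 i else i) else
  if i \in s2 then (if b.2 then next s2 i else i) else i.
Proof.
have e (c : bool) (s : seq 'I_n) (us : uniq s) j :
    (if c then cycle_perm us else 1%g) j = if c then next s j else j.
  by case: c; rewrite ?cycle_permE ?perm1.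
rewrite permM !e; have [is1|is1] := boolP (i \in s1).
  have h : (if b.1 then next s1 i else i) \in s1 by case: b.1; rewrite ?mem_next.
  by rewrite [next s2 _]next_notin ?s12 // if_same.
by rewrite [next s1 i]next_notin // if_same; have [//|is2] := boolP (i \in s2); rewrite next_notin // if_same.
Qed.

Lemma sub_cycle_perm_inj : injective sub_cycle_perm.
Proof.
have mem s : (1 < size s)%N -> exists i : 'I_n, i \in s.
  by case: s => // i s _; exists i; rewrite mem_head.
have [i is1] := mem _ len1; have [j js2] := mem _ len2.
have js1 : j \notin s1 by apply: contraTN js2 => /s12.
move=> [a b] [c d] e.
have := congr1 (fun s : 'S_n => s i) e; have := congr1 (fun s : 'S_n => s j) e.
rewrite !sub_cycle_permE is1 (negbTE js1) js2 /=.
have := next_neq us1 len1 is1; have := next_neq us2 len2 js2.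
move=> /eqP h2 /eqP h1 e2 e1.
have -> : a = c by case: a c e1 {e} => -[] // /esym.
by have -> : b = d by case: b d e2 {e} => -[] // /esym.
Qed.

(** The orbit of a moved vertex is a directed cycle, hence has the arcs of [s1] or of [s2]. One
    moved vertex therefore forces [s] to follow [next] on that whole cycle, and no vertex outside
    both cycles moves. *)
Lemma perm_of_arcs (s : 'S_n) : (forall j, s j != j -> A j (s j) != 0) ->
  exists b, s = sub_cycle_perm b.
Proof.
move=> sA.
have H i : s i != i -> (i \in s1 /\ {in s1, s =1 next s1}) \/ (i \in s2 /\ {in s2, s =1 next s2}).
  move=> si; have uo := orbit_uniq s i; have co := cycle_orbit (@perm_inj _ s) i.
  have := A_dcycle (is_dcycle_orbit (@perm_inj _ s) sA si).
  have K t : uniq t -> cycle_arcs (fingraph.orbit s i) = cycle_arcs t ->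
      i \in t /\ {in t, s =1 next t}.
    move=> ut e; have : (i, next (fingraph.orbit s i) i) \in cycle_arcs t.
      by rewrite -e mem_cycle_arcs // in_orbit /=.
    rewrite mem_cycle_arcs // => /andP[it _]; split=> // j jt.
    have : (j, next t j) \in cycle_arcs (fingraph.orbit s i) by rewrite e mem_cycle_arcs // jt /=.
    by rewrite mem_cycle_arcs // => /andP[jo /eqP->]; rewrite (nextE co jo).
  by case=> /K; [left; auto | right; auto].
exists ([exists i in s1, s i != i], [exists i in s2, s i != i]).
apply/permP => i; rewrite sub_cycle_permE /=.
case: ifPn => is1.
  case: ifPn => [/exists_inP[j js1 /H]|].
    by case=> -[js h]; [rewrite h | have := s12 js1; rewrite js].
  by rewrite negb_exists_in => /forall_inP /(_ i is1); rewrite negbK => /eqP.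
case: ifPn => is2.
  case: ifPn => [/exists_inP[j js2 /H]|].
    by case=> -[js h]; [have := s12 js; rewrite js2 | rewrite h].
  by rewrite negb_exists_in => /forall_inP /(_ i is2); rewrite negbK => /eqP.
by apply/eqP/idPn => /H[] []; [rewrite (negbTE is1) | rewrite (negbTE is2)].
Qed.

Let c1 := cycle_sign A (cycle_arcs s1).
Let c2 := cycle_sign A (cycle_arcs s2).

Lemma prod_next_char (s : seq 'I_n) : uniq s -> (1 < size s)%N ->
  \prod_(i in s) char_poly_mx A i (next s i) =
  (-1) ^+ size s * (cycle_sign A (cycle_arcs s))%:P.
Proof.
move=> us len; rewrite cycle_sign_arcs // rmorph_prod.
rewrite -(card_uniqP us) -prodrN; apply: eq_bigr => i is_.
by rewrite !mxE eq_sym (negbTE (next_neq us len is_)) mulr0n sub0r.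
Qed.

Lemma prod_diag_char (P : pred 'I_n) :
  \prod_(i | P i) char_poly_mx A i i = 'X ^+ #|P|.
Proof.
rewrite -prodr_const; apply: eq_big => // i _.
by rewrite !mxE eqxx A_diag mulr1n subr0.
Qed.

Lemma uniq_cat12 : uniq (s1 ++ s2).
Proof.
rewrite cat_uniq us1 us2 andbT; apply/hasPn => i is2 /=.
by apply: contraTN is2 => /s12.
Qed.

Lemma size_two_cycles : (size s1 + size s2 <= n)%N.
Proof. by rewrite -size_cat -(card_uniqP uniq_cat12) -[X in (_ <= X)%N]card_ord max_card. Qed.

(** The product over all vertices splits into [s1], [s2] and the rest; every fixed vertex gives a
    diagonal entry, which is ['X] for lack of loops. *)
Lemma term_sub_cycle_perm b :
  (-1) ^+ sub_cycle_perm b * \prod_i char_poly_mx A i (sub_cycle_perm b i) =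
  'X^(n - (size s1 + size s2)) * (if b.1 then - c1%:P else 'X^(size s1)) *
    (if b.2 then - c2%:P else 'X^(size s2)).
Proof.
pose out i := (i \notin s1) && (i \notin s2).
have cout : #|out| = (n - (size s1 + size s2))%N.
  rewrite -size_cat -(card_uniqP uniq_cat12) -[X in (X - _)%N]card_ord -(cardC (mem (s1 ++ s2))) addKn.
  by apply: eq_card => i; rewrite !inE mem_cat negb_or.
rewrite (bigID (mem s1)) /= [X in _ * (_ * X)](bigID (mem s2)) /=.
rewrite [X in _ * (_ * (_ * X))](_ : _ = 'X ^+ #|out|); last first.
  rewrite -prod_diag_char; apply: eq_bigr => i /andP[h1 h2].
  by rewrite sub_cycle_permE (negbTE h1) (negbTE h2).
rewrite cout.
have P1 : \prod_(i in s1) char_poly_mx A i (sub_cycle_perm b i) =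
    if b.1 then (-1) ^+ size s1 * c1%:P else 'X^(size s1).
  rewrite (eq_bigr (fun i => char_poly_mx A i (if b.1 then next s1 i else i))); last first.
    by move=> i is1; rewrite sub_cycle_permE is1.
  by case: b.1; rewrite ?prod_next_char // prod_diag_char (card_uniqP us1).
have P2 : \prod_(i | (i \notin s1) && (i \in s2)) char_poly_mx A i (sub_cycle_perm b i) =
    if b.2 then (-1) ^+ size s2 * c2%:P else 'X^(size s2).
  rewrite (eq_bigl (mem s2)) /=; last first.
    by move=> i; apply: andb_idl; apply: contraTN => /s12.
  rewrite (eq_bigr (fun i => char_poly_mx A i (if b.2 then next s2 i else i))); last first.
    move=> i is2; rewrite sub_cycle_permE is2 ifN //.
    by apply: contraTN is2 => /s12.
  by case: b.2; rewrite ?prod_next_char // prod_diag_char (card_uniqP us2).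
rewrite P1 P2 odd_permM.
(* A cycle of length k has permutation sign (-1)^(k-1), while its k off-diagonal entries give
   (-1)^k; a single minus sign is left. *)
have sg (c : bool) (s : seq 'I_n) (us : uniq s) (a : {poly int}) : (0 < size s)%N ->
   (-1) ^+ (if c then cycle_perm us else 1%g) * (if c then (-1) ^+ size s * a else 'X^(size s)) =
   if c then - a else 'X^(size s).
  move=> l; case: c; last by rewrite odd_perm1 mul1r.
  by rewrite odd_cycle_perm // mulrA -[_ ^+ size s]signr_odd -signr_addb addNb addbb mulN1r.
rewrite signr_addb -(sg b.1 _ us1 _ (ltnW len1)) -(sg b.2 _ us2 _ (ltnW len2)).
have reorder (K : comNzRingType) (u v w x y : K) : u * v * (w * (x * y)) = y * (u * w) * (v * x) by ring.
exact: reorder.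
Qed.

Lemma char_poly_two_cycles :
  char_poly A = 'X^(n - (size s1 + size s2)) * ('X^(size s1) - c1%:P) * ('X^(size s2) - c2%:P).
Proof.
rewrite /char_poly /determinant (bigID (mem [set sub_cycle_perm b | b in [set: bool * bool]])) /=.
rewrite [X in _ + X]big1 ?addr0 => [|s sn]; last first.
  (* By contraposition: a nonzero term has no zero factor, so each vertex moved by [s] follows an
     arc and [perm_of_arcs] applies. *)
  apply/eqP; rewrite mulf_eq0 signr_eq0 /=; apply: contraNT sn => s0.
  have [j sj|b ->] := @perm_of_arcs s; last exact: imset_f.
  move/prodf_neq0: s0 => /(_ j isT).
  by rewrite !mxE [j == _]eq_sym (negbTE sj) mulr0n sub0r oppr_eq0 polyC_eq0.
rewrite big_imset /=; last by move=> b c _ _; apply: sub_cycle_perm_inj.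
rewrite (eq_bigr _ (fun b _ => term_sub_cycle_perm b)).
rewrite (eq_bigl xpredT) => [|b]; last by rewrite inE.
rewrite -(pair_bigA _ (fun a b => 'X^(n - (size s1 + size s2)) * (if a then - c1%:P else 'X^(size s1)) *
    (if b then - c2%:P else 'X^(size s2)))) /=.
rewrite !big_bool /=.
have expand (K : comNzRingType) (u v w x y : K) :
  u * - v * - w + u * - v * y + (u * x * - w + u * x * y) = u * (x - v) * (y - w) by ring.
exact: expand.
Qed.

End TwoCycles.

(** * Existence of the extremal sidigraphs *)

(** The permutation (0 1)(2 3 ... q+1) of the naturals, identity beyond [q.+1], for [q] at least
    2. *)
Definition succ_nat (q i : nat) : nat :=
  if i == 0%N then 1 else if i == 1%N then 0 else
  if (i <= q)%N then i.+1 else if i == q.+1 then 2 else i.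

Lemma succ_nat_inj (q : nat) : (1 < q)%N -> injective (succ_nat q).
Proof. by move=> q1 i j; rewrite /succ_nat; repeat case: ifP; lia. Qed.

Lemma succ_nat_lt (n q i : nat) : (q.+2 <= n)%N -> (i < n)%N -> (succ_nat q i < n)%N.
Proof. by rewrite /succ_nat; repeat case: ifP; lia. Qed.

Section Witness.
Variables (n q : nat) (c : int).
Hypotheses (q1 : (1 < q)%N) (qn : (q.+2 <= n)%N) (c_unit : c = 1 \/ c = -1).

Definition succ_ord (i : 'I_n) : 'I_n := Ordinal (succ_nat_lt qn (ltn_ord i)).

(* The cycles [0 -> 1 -> 0] and [2 -> ... -> q + 1 -> 2], joined by [0 -> 2]; the remaining vertices are sinks fed by [0]. *)
Definition witness : 'M[int]_n := \matrix_(i, j)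
  if (i == 1 :> nat) && (j == 0 :> nat) then c else
  ((i < q.+2)%N && (j == succ_ord i) || (i == 0 :> nat) && ((j == 2 :> nat) || (q.+2 <= j)%N))%:R.

Lemma succ_ord_inj : injective succ_ord.
Proof. by move=> i j /(congr1 val) /(succ_nat_inj q1) /val_inj. Qed.

Lemma witness_neq0 i j : (witness i j != 0) =
  (i < q.+2)%N && (j == succ_ord i) || (i == 0 :> nat) && ((j == 2 :> nat) || (q.+2 <= j)%N).
Proof.
rewrite mxE; case: ifP => [/andP[/eqP i1 /eqP j0]|_].
  rewrite -val_eqE /= i1 j0 /=; case: c_unit => -> //.
by case: (_ || _).
Qed.

Lemma witness_sidigraph : sidigraph witness.
Proof.
split=> [i j|i].
  rewrite mxE; case: ifP => _; first by case: c_unit => ->.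
  by case: (_ || _).
apply/eqP/negPn; rewrite witness_neq0 -val_eqE /= /succ_nat.
by repeat case: ifP; lia.
Qed.

Lemma vertex_lt i : (i < q.+2)%N -> (i < n)%N. Proof. by move=> h; apply: leq_trans qn. Qed.

Definition v0 : 'I_n := Ordinal (vertex_lt (isT : 0 < q.+2)%N).
Definition v2 : 'I_n := Ordinal (vertex_lt (ltnW q1 : 2 < q.+2)%N).

Lemma val_iter_succ k i : val (iter k succ_ord i) = iter k (succ_nat q) (val i).
Proof. by elim: k => //= k ->. Qed.

Lemma iter_succ_nat k : (k < q)%N -> iter k (succ_nat q) 2 = k.+2.
Proof. by elim: k => //= k IH kq; rewrite IH 1?ltnW // /succ_nat /= kq. Qed.

Lemma orbit_v0 i : (i \in fingraph.orbit succ_ord v0) = (i < 2)%N.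
Proof.
rewrite -fconnect_orbit; apply/idP/idP.
  move/iter_findex => <-; rewrite val_iter_succ; elim: (findex _ _ _) => //= k.
  by case: (iter _ _ _) => [|[|]].
case: i => -[|[|//]] hi _; last by rewrite (_ : Ordinal _ = succ_ord v0) ?fconnect1 //; apply: val_inj.
by rewrite (_ : Ordinal _ = v0) ?connect0 //; apply: val_inj.
Qed.

Lemma orbit_v2 i : (i \in fingraph.orbit succ_ord v2) = (1 < i < q.+2)%N.
Proof.
rewrite -fconnect_orbit; apply/idP/idP.
  move/iter_findex => <-; rewrite val_iter_succ; elim: (findex _ _ _) => [|k] /=; first by lia.
  by move: (iter _ _ _) => m; rewrite /succ_nat; repeat case: ifP; lia.
move=> /andP[i1 iq]; have -> : i = iter (i - 2) succ_ord v2.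
  by apply: val_inj; rewrite val_iter_succ iter_succ_nat /=; lia.
exact: fconnect_iter.
Qed.

Lemma dcycle_succ (i : 'I_n) : (i < q.+2)%N -> is_dcycle witness (cycle_arcs (fingraph.orbit succ_ord i)).
Proof.
have fix_big (j : 'I_n) : succ_ord j != j -> (j < q.+2)%N.
  by rewrite -val_eqE /= /succ_nat; repeat case: ifP; lia.
move=> iq; apply: is_dcycle_orbit succ_ord_inj _ _.
  by move=> j /fix_big jq; rewrite witness_neq0 jq eqxx.
by rewrite -val_eqE /= /succ_nat; move: iq; repeat case: ifP; lia.
Qed.

Lemma mem_orbit_arcs i j k :
  ((j, k) \in cycle_arcs (fingraph.orbit succ_ord i)) =
  (j \in fingraph.orbit succ_ord i) && (k == succ_ord j).
Proof.
rewrite mem_cycle_arcs ?orbit_uniq //; have [jo|//] := boolP (j \in _).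
by rewrite (nextE (cycle_orbit succ_ord_inj i) jo).
Qed.

(** The sinks have no outgoing arc, and the arc from 0 to 2 leads to vertices from which 0 cannot be
    reached. A directed cycle thus follows [succ_ord] everywhere and is one of its orbits. *)
Lemma dcycle_witness D : is_dcycle witness D ->
  D = cycle_arcs (fingraph.orbit succ_ord v0) \/ D = cycle_arcs (fingraph.orbit succ_ord v2).
Proof.
move=> [s [len us -> nz]].
have arc i : i \in s -> witness i (next s i) != 0.
  by move=> is_; apply: (nz (i, next s i)); rewrite mem_cycle_arcs // is_ /=.
have small i : i \in s -> (i < q.+2)%N.
  by move/arc; rewrite witness_neq0; lia.
have conn i j : i \in s -> j \in s -> exists k, j = iter k (next s) i.
  move=> is_ js; have := fconnect_cycle (cycle_next us) is_ j; rewrite js.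
  by move/iter_findex <-; eexists.
have nextS i : i \in s -> next s i = succ_ord i.
  move=> is_; have ns : next s i \in s by rewrite mem_next.
  have := arc i is_; rewrite witness_neq0 => /orP[/andP[_ /eqP] //|/andP[/eqP i0 /orP[/eqP n2|]]]; last first.
    by have := small _ ns; lia.
  (* The case left is the arc from 0 to 2. Following the cycle from 2 must lead back to 0, yet arcs
     leaving vertices above 1 end above 1. *)
  have [k kE] := conn _ _ ns is_.
  have : (1 < iter k (next s) (next s i))%N && (iter k (next s) (next s i) \in s).
    elim: k {kE} => [|k /andP[/= k1 ks]]; first by rewrite /= n2 ns.
    rewrite /= mem_next ks andbT; have := arc _ ks; rewrite witness_neq0 -val_eqE /=.
    by rewrite /succ_nat; repeat case: ifP; lia.
  by rewrite -kE i0.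
have fs : fcycle succ_ord s.
  by apply: cycle_from_next => // i is_; rewrite /= nextS.
have [i is_] : exists i, i \in s by case: (s) len => // i t _; exists i; rewrite mem_head.
have arcsE v : i \in fingraph.orbit succ_ord v -> cycle_arcs s = cycle_arcs (fingraph.orbit succ_ord v).
  move=> iv; apply/setP => -[j k]; rewrite mem_orbit_arcs mem_cycle_arcs //.
  have -> : (j \in fingraph.orbit succ_ord v) = (j \in s).
    (* Both [s] and the orbit of [v] are cyclic lists for [succ_ord] through [i], hence rotations of
       the orbit of [i]. *)
    have := fingraph.orbitE (cycle_orbit succ_ord_inj v) (orbit_uniq _ _) iv.
    by rewrite (fingraph.orbitE fs us is_) => /(congr1 (fun t => j \in t)); rewrite !mem_rot.
  by have [js|//] := boolP (j \in s); rewrite nextS.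
have [i2|i2] := ltnP i 2; [left|right]; apply: arcsE; rewrite ?orbit_v0 ?orbit_v2 ?i2 //.
exact: small.
Qed.

Lemma size_orbit_interval (v : 'I_n) a b :
  (forall i, (i \in fingraph.orbit succ_ord v) = (a <= i < b)%N) -> (b <= n)%N ->
  size (fingraph.orbit succ_ord v) = (b - a)%N.
Proof.
move=> memo bn; rewrite -(size_map val) -(size_iota a (b - a)); apply/perm_size/uniq_perm.
- by rewrite map_inj_uniq ?orbit_uniq //; apply: val_inj.
- exact: iota_uniq.
move=> x; rewrite mem_iota; apply/mapP/idP => [[i io ->]|xab]; first by move: io; rewrite memo /=; lia.
have xn : (x < n)%N by lia.
by exists (Ordinal xn); rewrite // memo /=; lia.
Qed.

(** Only the arc from 1 to 0 carries [c]; all other arcs are positive. *)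
Lemma witness_sign (v : 'I_n) : (v < q.+2)%N ->
  cycle_sign witness (cycle_arcs (fingraph.orbit succ_ord v)) =
  \prod_(i in fingraph.orbit succ_ord v) (if i == 1 :> nat then c else 1).
Proof.
move=> vq; rewrite cycle_sign_arcs ?orbit_uniq //; apply: eq_bigr => i io.
have [s [_ us _ nz]] := dcycle_succ vq.
have := nz (i, succ_ord i); rewrite mem_orbit_arcs io eqxx => /(_ isT) /=.
rewrite (nextE (cycle_orbit succ_ord_inj v) io) witness_neq0 mxE => ->.
by rewrite /= /succ_nat; case: (nat_of_ord i) => [|[|]].
Qed.

Lemma witness_two_cycles : exactly_two_cycles witness
  (cycle_arcs (fingraph.orbit succ_ord v0)) (cycle_arcs (fingraph.orbit succ_ord v2)).
Proof.
split; [| by apply: dcycle_succ | by apply: dcycle_succ; rewrite /= ltnS ltnW | | exact: dcycle_witness].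
  apply/eqP => /setP/(_ (v0, succ_ord v0)).
  by rewrite !mem_orbit_arcs eqxx !andbT orbit_v0 orbit_v2.
rewrite !cycle_verts_arcs ?orbit_uniq //; apply/pred0P => i /=.
by rewrite !inE orbit_v0 orbit_v2; lia.
Qed.

(** Everything is reached from [v0]: its own orbit, then [v2] and its orbit through the joining arc,
    and each sink by one arc. *)
Lemma witness_connected : underlying_connected witness.
Proof.
pose e := fun x y => (witness x y != 0) || (witness y x != 0).
have csym : connect_sym e.
  by apply: sym_connect_sym => x y; rewrite /e orbC.
have arc i j : witness i j != 0 -> connect e i j by move=> h; rewrite connect1 // /e h.
have v02 : connect e v0 v2 by apply: arc; rewrite witness_neq0 orbT.
suff from0 i : connect e v0 i by move=> i j; apply: (connect_trans _ (from0 j)); rewrite -/e csym.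
have [iq|iq] := ltnP i q.+2; last first.
  by apply: arc; rewrite witness_neq0 iq !orbT.
have orb (v j : 'I_n) : (v < q.+2)%N -> j \in fingraph.orbit succ_ord v -> connect e v j.
  move=> vq jo; have : j \in fingraph.orbit succ_ord v by [].
  rewrite -fconnect_orbit => /iter_findex <-; elim: (findex _ _ _) => [|k IH]; first exact: connect0.
  apply: connect_trans IH _; rewrite iterS; have [s [_ _ _ nz]] := dcycle_succ vq.
  apply: arc; apply: (nz (_, _)); rewrite mem_orbit_arcs eqxx andbT.
  by rewrite -fconnect_orbit fconnect_iter.
have [i2|i2] := ltnP i 2; first by apply: orb => //; rewrite orbit_v0.
by apply: connect_trans v02 _; apply: orb; [exact: (ltnW q1) | rewrite orbit_v2 i2].
Qed.

Lemma witness_Dns_with : Dns_with witness 2 c q 1.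
Proof.
split.
  split; [exact: witness_sidigraph | exact: witness_connected |].
  by do 2 eexists; exact: witness_two_cycles.
exists (cycle_arcs (fingraph.orbit succ_ord v0)), (cycle_arcs (fingraph.orbit succ_ord v2)).
have q2n : (2 <= n)%N by lia.
split; first exact: witness_two_cycles.
- by rewrite cycle_len_arcs ?orbit_uniq // (@size_orbit_interval v0 0 2) //; exact: orbit_v0.
- have v1o : succ_ord v0 \in fingraph.orbit succ_ord v0 by rewrite orbit_v0.
  rewrite witness_sign // (bigD1 _ v1o) /= big1 ?mulr1 // => i /andP[_ h].
  by case: ifP => // i1; move: h; rewrite -val_eqE /= (eqP i1).
- by rewrite cycle_len_arcs ?orbit_uniq // (@size_orbit_interval v2 2 q.+2) ?subn2 //; exact: orbit_v2.
rewrite (@witness_sign v2 (ltnW q1)) big1 // => i; rewrite orbit_v2.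
by case: eqP => // ->.
Qed.

End Witness.

(** * Embedding an archimedean field in the reals *)

Section RealEmbedding.
Variables (F : archiRealFieldType) (R : realType).

(** The supremum of the Dedekind cut of [x], taken in the complete field [R]; it carries real
    algebraic numbers to where sine and cosine live. *)
Definition real_embed (x : F) : R :=
  sup [set y | exists2 q : rat, y = ratr q & ratr q <= x]%classic.

(** Strict on the side of [x] and weak on the side of [y]: a supremum satisfies this directly, and
    [y] is still determined. Morphism laws then reduce to checking cuts. *)
Definition same_cut (x : F) (y : R) : Prop :=
  forall q : rat, (ratr q < x -> ratr q <= y) /\ (x < ratr q -> y <= ratr q).

Lemma rat_between (K : archiRealFieldType) (x y : K) :
  x < y -> exists2 q : rat, x < ratr q & ratr q < y.
Proof. by case/rat_in_itvoo=> q; rewrite in_itv /= => /andP[]; exists q. Qed.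

Lemma real_embed_cut x : same_cut x (real_embed x).
Proof.
have [q0 _ q0x] : exists2 q : rat, x - 1 < ratr q & ratr q < x.
  by apply: rat_between; rewrite ltrBlDr ltrDl ltr01.
have [q1 xq1 _] : exists2 q : rat, x < ratr q & ratr q < x + 1.
  by apply: rat_between; rewrite ltrDl ltr01.
have ubq q : x <= ratr q -> ubound [set y : R | exists2 q : rat, y = ratr q & ratr q <= x]%classic (ratr q).
  move=> xq _ [r -> rx]; rewrite ler_rat.
  by have:= le_trans rx xq; rewrite ler_rat.
split=> hq.
  apply: ub_le_sup; first by exists (ratr q1); apply: ubq; apply: ltW.
  by exists q => //; apply: ltW.
apply: ge_sup; last by apply: ubq; apply: ltW.
by exists (ratr q0), q0 => //; apply: ltW.
Qed.

Lemma same_cut_unique x y z : same_cut x y -> same_cut x z -> y = z.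
Proof.
suff H a b : same_cut x a -> same_cut x b -> ~~ (a < b).
  move=> cy cz; apply/eqP; rewrite eq_le !leNgt.
  by rewrite (H _ _ cy cz) (H _ _ cz cy).
(* Two rationals [a < r < q < b] are taken because the cuts only yield [q <= x <= r], which a single
   rational would not contradict. *)
move=> ca cb; apply/negP => /rat_between[q aq qb].
have [r ar rq] := rat_between aq.
have [_ h1] := cb q; have [h2 _] := ca r.
have : ~~ (x < ratr q) by apply/negP => xq; have:= h1 xq; rewrite leNgt qb.
have : ~~ (ratr r < x) by apply/negP => rx; have:= h2 rx; rewrite leNgt ar.
rewrite -!leNgt => xr qx.
by have:= le_trans qx xr; rewrite ler_rat leNgt -(ltr_rat R) rq.
Qed.

Lemma real_embedE x y : same_cut x y -> real_embed x = y.
Proof. exact/same_cut_unique/real_embed_cut. Qed.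

(** A rational below [x + y] splits as [r + (q - r)] with [r] below [x] and [q - r] below [y];
    likewise above. *)
Lemma same_cutD x y a b : same_cut x a -> same_cut y b -> same_cut (x + y) (a + b).
Proof.
move=> cx cy q; split=> hq.
  have [r ] : exists2 r : rat, ratr q - y < ratr r & ratr r < x.
    by apply: rat_between; rewrite ltrBlDr.
  rewrite ltrBlDr -ltrBlDl -rmorphB => ry rx.
  rewrite -(subrKC r q) rmorphD lerD //; first by have [->] := cx r.
  by have [->] := cy (q - r).
have [r ] : exists2 r : rat, x < ratr r & ratr r < ratr q - y.
  by apply: rat_between; rewrite ltrBrDr.
rewrite ltrBrDr -ltrBrDl -rmorphB => rx ry.
rewrite -(subrKC r q) rmorphD lerD //; first by have [_ ->] := cx r.
by have [_ ->] := cy (q - r).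
Qed.

(** A positive rational splits as [r * (q / r)], and a nonpositive one lies below [a * b] anyway.
    Other signs of [x] and [y] are reduced to this case in [real_embedM]. *)
Lemma same_cutM x y a b : 0 < x -> 0 < y -> 0 <= a -> 0 <= b ->
  same_cut x a -> same_cut y b -> same_cut (x * y) (a * b).
Proof.
move=> x0 y0 a0 b0 cx cy q; split=> hq.
  have [q0|q0] := leP q 0; first by apply: le_trans (mulr_ge0 a0 b0); rewrite lerq0.
  have [r ] : exists2 r : rat, ratr q / y < ratr r & ratr r < x.
    by apply: rat_between; rewrite ltr_pdivrMr.
  move=> ry rx.
  have r0 : 0 < r by rewrite -(ltr0q F); apply: le_lt_trans ry; rewrite divr_ge0 ?ler0q ?ltW.
  have {ry} : ratr (q / r) < y.
    by rewrite fmorph_div ltr_pdivrMr ?ltr0q // mulrC -ltr_pdivrMr.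
  move=> ry; rewrite -(divfK (lt0r_neq0 r0) q) [q / r * r]mulrC rmorphM ler_pM ?ler0q //.
  - exact: ltW.
  - by rewrite divr_ge0 ?ltW.
  - by have [->] := cx r.
  by have [->] := cy (q / r).
have [r ] : exists2 r : rat, x < ratr r & ratr r < ratr q / y.
  by apply: rat_between; rewrite ltr_pdivlMr.
move=> rx ry.
have r0 : 0 < r by rewrite -(ltr0q F); apply: lt_trans rx.
have {ry} : y < ratr (q / r).
  by rewrite fmorph_div ltr_pdivlMr ?ltr0q // mulrC -ltr_pdivlMr.
move=> ry; rewrite -(divfK (lt0r_neq0 r0) q) [q / r * r]mulrC rmorphM ler_pM //.
- by have [_ ->] := cx r.
by have [_ ->] := cy (q / r).
Qed.

Lemma same_cut_rat q : same_cut (ratr q) (ratr q).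
Proof. by move=> r; rewrite !ler_rat !ltr_rat; split; apply: ltW. Qed.

Lemma real_embedD : {morph real_embed : x y / x + y}.
Proof.
by move=> x y; apply/real_embedE/same_cutD; apply: real_embed_cut.
Qed.

Lemma real_embed0 : real_embed 0 = 0.
Proof.
by apply: real_embedE; have:= same_cut_rat 0; rewrite !rmorph0.
Qed.

Lemma real_embedN : {morph real_embed : x / - x}.
Proof.
by move=> x; apply/eqP; rewrite -addr_eq0 -real_embedD addNr real_embed0.
Qed.

Lemma real_embed_gt0 x : 0 < x -> 0 < real_embed x.
Proof.
move=> /rat_between[q q0 qx]; have [/(_ qx) + _] := real_embed_cut x q.
by apply: lt_le_trans; rewrite ltr0q -(ltr0q F).
Qed.

Lemma real_embed1 : real_embed 1 = 1.
Proof.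
by apply: real_embedE; have:= same_cut_rat 1; rewrite !rmorph1.
Qed.

Lemma real_embedM : {morph real_embed : x y / x * y}.
Proof.
have posM x y : 0 < x -> 0 < y -> real_embed (x * y) = real_embed x * real_embed y.
  move=> x0 y0; apply/real_embedE/same_cutM => //; rewrite ?ltW ?real_embed_gt0 //;
  exact: real_embed_cut.
have posMl x y : 0 < x -> real_embed (x * y) = real_embed x * real_embed y.
  move=> x0; have [y0|y0|->] := ltgtP y 0; last by rewrite mulr0 real_embed0 mulr0.
    by apply: oppr_inj; rewrite -mulrN -!real_embedN -mulrN posM ?oppr_gt0.
  exact: posM.
move=> x y; have [x0|x0|->] := ltgtP x 0; last by rewrite mul0r real_embed0 mul0r.
  by apply: oppr_inj; rewrite -mulNr -!real_embedN -mulNr posMl ?oppr_gt0.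
exact: posMl.
Qed.

Lemma real_embed_is_zmod_morphism : zmod_morphism real_embed.
Proof. by move=> x y; rewrite real_embedD real_embedN. Qed.

Lemma real_embed_is_monoid_morphism : monoid_morphism real_embed.
Proof. by split; [exact: real_embed1 | exact: real_embedM]. Qed.

HB.instance Definition _ :=
  GRing.isZmodMorphism.Build F R real_embed real_embed_is_zmod_morphism.
HB.instance Definition _ :=
  GRing.isMonoidMorphism.Build F R real_embed real_embed_is_monoid_morphism.

Lemma ltr_real_embed : {mono real_embed : x y / x < y}.
Proof.
apply: leW_mono; apply: le_mono => x y.
by rewrite -subr_gt0 => /real_embed_gt0; rewrite rmorphB subr_gt0.
Qed.

Lemma ler_real_embed : {mono real_embed : x y / x <= y}.
Proof. by move=> x y; rewrite !leNgt ltr_real_embed. Qed.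

Lemma real_embed_norm x : real_embed `|x| = `|real_embed x|.
Proof.
have [x0|x0] := leP 0 x; first by rewrite !ger0_norm // -real_embed0 ler_real_embed.
by rewrite !ltr0_norm ?rmorphN // -real_embed0 ltr_real_embed.
Qed.

End RealEmbedding.

(** * Sums of cosines *)

Local Notation R := Rdefinitions.R.
Local Notation C := R[i].
Local Notation pi := Rtrigo1.PI.
Local Arguments sin x%_ring_scope.
Local Arguments cos x%_ring_scope.

Lemma cos_pi : cos pi = -1.
Proof. exact: cos_PI. Qed.

Lemma sin_pi : sin pi = 0.
Proof. exact: sin_PI. Qed.

Lemma cosB_pi (x : R) : cos (pi - x) = - cos x.
Proof. by rewrite cosD (cos_neg x : cos (- x) = _) cos_pi sin_pi mul0r subr0 mulN1r. Qed.

(** The sum telescopes, as twice [sin x] times the cosine of 2(M+1)x is sin((2M+3)x) -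
    sin((2M+1)x). *)
Lemma dirichlet_kernel (x : R) (M : nat) :
  sin x * (1 + 2 * \sum_(k < M) cos (2 * k.+1%:R * x)) = sin ((2 * M + 1)%:R * x).
Proof.
elim: M => [|M IH]; first by rewrite big_ord0 mulr0 addr0 mulr1 mul1r.
rewrite big_ord_recr /= [2 * (_ + _)]mulrDr addrA [sin x * _]mulrDr IH.
have -> : (2 * M.+1 + 1)%:R * x = 2 * M.+1%:R * x + x by rewrite natrD natrM; ring.
have -> : (2 * M + 1)%:R * x = 2 * M.+1%:R * x - x by rewrite natrD natrM -[M.+1]addn1 natrD; ring.
rewrite !sinD (sin_neg x : sin (- x) = _) (cos_neg x : cos (- x) = _) RoppE; ring.
Qed.

(** Half the sum of |Re z| over the 2N-th roots of unity. *)
Definition half_cos_sum (N : nat) : R := \sum_(k < N) `|cos (k%:R * (pi / N%:R))|.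

Lemma cos_pi2 : cos (pi / 2) = 0.
Proof. exact: cos_PI2. Qed.

Lemma sin_pi2 : sin (pi / 2) = 1.
Proof. exact: sin_PI2. Qed.

Lemma pi_gt0 : 0 < pi. Proof. exact/RltP/PI_RGT_0. Qed.

Lemma cos_ge0 (x : R) : 0 <= x -> 2 * x <= pi -> 0 <= cos x.
Proof.
move=> /RleP x0 /RleP xp; apply/RleP/cos_ge_0.
  by have : Rle (IZR 0) x by []; have := PI_RGT_0; Lra.lra.
have : Rle (Rmult (IZR 2) x) pi by []; have := PI_RGT_0; Lra.lra.
Qed.

Lemma sin_pi_div_gt0 (N : nat) : (1 < N)%N -> 0 < sin (pi / N%:R).
Proof.
move=> N1; have N0 : 0 < (N%:R : R) by rewrite ltr0n ltnW.
apply/RltP; apply: sin_gt_0; apply/RltP; first by rewrite divr_gt0 ?pi_gt0.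
by rewrite ltr_pdivrMr // ltr_pMr ?pi_gt0 // ltr1n.
Qed.

Lemma abs_cos_reflect (N k : nat) : (0 < N)%N -> (k <= N)%N ->
  `|cos ((N - k)%:R * (pi / N%:R))| = `|cos (k%:R * (pi / N%:R))|.
Proof.
move=> N0 kN; rewrite natrB // mulrBl mulrCA divff ?pnatr_eq0 -?lt0n // mulr1.
by rewrite cosB_pi normrN.
Qed.

Lemma abs_cos_lower_half (N k : nat) : (k.*2 <= N)%N ->
  `|cos (k%:R * (pi / N%:R))| = cos (k%:R * (pi / N%:R)).
Proof.
case: N => [|N] kN; first by move: kN; rewrite leqn0 double_eq0 => /eqP->; rewrite !mul0r cos_0 normr1.
rewrite ger0_norm // cos_ge0 //.
  by rewrite mulr_ge0 // divr_ge0 ?ltW ?pi_gt0.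
rewrite mulrCA mulrA mulrA ler_pdivrMr ?ltr0n // [_ * pi]mulrC ler_pM2l ?pi_gt0 //.
by rewrite -natrM ler_nat muln2.
Qed.

(** The term k = 0 is 1, the terms 1 to M are nonnegative cosines, and k -> N - k reflects them onto
    the last M terms. For N = 2M+2 the middle term is cos(pi/2) = 0. *)
Lemma half_cos_sum_dirichlet (N M : nat) : (0 < N)%N ->
  N = M.*2.+1 \/ N = M.*2.+2 ->
  half_cos_sum N = 1 + 2 * \sum_(k < M) cos (2 * k.+1%:R * (pi / (2 * N%:R))).
Proof.
move=> N0 HN.
have NR : (N%:R : R) != 0 by rewrite pnatr_eq0 -lt0n.
have -> : \sum_(k < M) cos (2 * k.+1%:R * (pi / (2 * N%:R))) =
          \sum_(1 <= k < M.+1) `|cos (k%:R * (pi / N%:R))|.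
  rewrite big_add1 /= big_mkord; apply: eq_bigr => k _.
  rewrite abs_cos_lower_half; first by congr cos; field.
  by have := ltn_ord k; case: HN => ->; lia.
have refl : \sum_(N - M <= k < N) `|cos (k%:R * (pi / N%:R))| =
            \sum_(1 <= k < M.+1) `|cos (k%:R * (pi / N%:R))|.
  rewrite big_nat_rev /= [in RHS]big_add1 -{1}[(N - M)%N]add0n big_addn subKn; last by lia.
  rewrite !big_mkord; apply: eq_bigr => k _ /=.
  rewrite -[RHS]abs_cos_reflect //; last by have:= ltn_ord k; lia.
  by congr (`|cos (_%:R * _)|); have:= ltn_ord k; lia.
rewrite /half_cos_sum -(big_mkord xpredT (fun k => `|cos (k%:R * (pi / N%:R))|)).
rewrite big_ltn // mul0r cos_0 normr1 mulr2n mulrDl mul1r; congr (_ + _).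
rewrite (big_cat_nat (n := M.+1)) //=; last by lia.
congr (_ + _); rewrite -refl.
case: HN => HN; first by rewrite HN (_ : M.*2.+1 - M = M.+1)%N //; lia.
rewrite big_ltn; last by lia.
rewrite (_ : N - M = M.+2)%N; last by lia.
rewrite (_ : cos _ = 0) ?normr0 ?add0r //.
rewrite -[RHS]cos_pi2; congr cos.
rewrite HN (_ : M.*2.+2%:R = 2 * M.+1%:R); last by rewrite -natrM; congr _%:R; lia.
by field; rewrite ?natr1 ?nat1r pnatr_eq0.
Qed.

(** The Dirichlet kernel at x = pi/(2N): the numerator is sin(Nx) = 1 for odd N and sin((N-1)x) =
    cos x for even N. *)
Lemma half_cos_sumE (N : nat) : (0 < N)%N ->
  half_cos_sum N = (if odd N then 1 else cos (pi / (2 * N%:R))) / sin (pi / (2 * N%:R)).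
Proof.
move=> N0; set x := pi / _.
have NR : (N%:R : R) != 0 by rewrite pnatr_eq0 -lt0n.
have xE : N%:R * x = pi / 2 by rewrite /x; field.
have sx : sin x != 0.
  by apply/lt0r_neq0; rewrite /x -natrM sin_pi_div_gt0 //; lia.
apply: (mulfI sx); rewrite mulrCA divff // mulr1.
case: ifP => oN.
  rewrite (@half_cos_sum_dirichlet _ N./2) //; last by left; lia.
  rewrite dirichlet_kernel (_ : _ + 1 = N)%N; last by lia.
  by rewrite xE sin_pi2.
rewrite (@half_cos_sum_dirichlet _ N./2.-1) //; last by right; lia.
rewrite dirichlet_kernel (_ : _ + 1 = N - 1)%N; last by lia.
rewrite natrB // mulrBl mul1r xE sinD (cos_neg x : cos (- x) = _).
by rewrite sin_pi2 cos_pi2 mul1r mul0r addr0.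
Qed.

(** * Energy of a polynomial *)

Definition root_energy (P : {poly C}) : R :=
  \sum_(z <- sval (closed_field_poly_normal P)) `|complex.Re z|.

Lemma root_energy_prod (s : seq C) :
  root_energy (\prod_(z <- s) ('X - z%:P)) = \sum_(z <- s) `|complex.Re z|.
Proof.
rewrite /root_energy; case: closed_field_poly_normal => r /= Hr.
apply: perm_big; apply: prod_XsubC_eq; rewrite [RHS]Hr.
by rewrite lead_coef_prod_XsubC scale1r.
Qed.

Lemma monic_prod_roots (P : {poly C}) : P \is monic ->
  exists s : seq C, P = \prod_(z <- s) ('X - z%:P).
Proof.
move=> /monicP mP; case: (closed_field_poly_normal P) => r.
by rewrite mP scale1r; exists r.
Qed.

Lemma root_energyM (P Q : {poly C}) : P \is monic -> Q \is monic ->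
  root_energy (P * Q) = root_energy P + root_energy Q.
Proof.
move=> /monic_prod_roots[s ->] /monic_prod_roots[t ->].
by rewrite -big_cat !root_energy_prod big_cat.
Qed.

Lemma root_energyXn (n : nat) : root_energy 'X^n = 0.
Proof.
have -> : 'X^n = \prod_(z <- nseq n (0 : C)) ('X - z%:P).
  by rewrite big_nseq subr0 -Monoid.iteropE; elim: n => // n IH; rewrite exprS IH.
rewrite root_energy_prod big_nseq; elim: n => //= n ->.
by rewrite normr0 addr0.
Qed.

(** * Roots of unity and the energies of X^m - 1 and X^m + 1 *)

Definition cis (t : R) : C := Complex (cos t) (sin t).
Local Arguments cis t%_ring_scope.

Lemma cisD (s t : R) : cis (s + t) = cis s * cis t.
Proof. by rewrite /cis cosD sinD; congr Complex; rewrite addrC mulrC [X in _ + X]mulrC. Qed.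

Lemma cisX (t : R) (k : nat) : cis t ^+ k = cis (k%:R * t).
Proof.
elim: k => [|k IH]; first by rewrite expr0 mul0r /cis cos_0 sin_0.
by rewrite exprS IH -cisD -nat1r mulrDl mul1r.
Qed.

Lemma cis_neq1 (t : R) : 0 < t -> t < pi -> cis (2 * t) != 1.
Proof.
move=> t0 tp; apply/eqP => /(congr1 (@complex.Re R)) /= h.
have s0 : 0 < sin t by apply/RltP/sin_gt_0; apply/RltP.
move: h; rewrite mulrDl mul1r cosD => h.
have := sin2_cos2 t; rewrite /Rsqr => h2.
have {h2} h2 : sin t * sin t + cos t * cos t = 1 by [].
have : sin t * sin t = 0 by lra.
by move/eqP; rewrite mulf_eq0 (gt_eqF s0).
Qed.

(** Were the order [d] smaller than [m], the point of angle 2t with t = pi d/m strictly between 0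
    and pi would equal 1. *)
Lemma prim_root_cis (m : nat) : (0 < m)%N -> m.-primitive_root (cis (2 * pi / m%:R)).
Proof.
move=> m0; have mR : (m%:R : R) != 0 by rewrite pnatr_eq0 -lt0n.
have zm : cis (2 * pi / m%:R) ^+ m = 1.
  rewrite cisX mulrCA divff // mulr1 mulrDl mul1r cisD /cis cos_pi sin_pi.
  by apply/eqP; rewrite eq_complex /=; apply/andP; split; apply/eqP; ring.
set z := cis _ in zm *; have [d dz dm] := prim_order_exists m0 zm.
have [dm'|md] := ltnP d m; last first.
  by have <- : d = m by apply/eqP; rewrite eqn_leq md dvdn_leq.
have d0 := prim_order_gt0 dz.
have /eqP := prim_expr_order dz; rewrite /z cisX.
have -> : d%:R * (2 * pi / m%:R) = 2 * (d%:R / m%:R * pi) by ring.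
have mR0 : 0 < (m%:R : R) by rewrite ltr0n.
rewrite (negbTE (cis_neq1 _ _)) //.
  by rewrite mulr_gt0 ?pi_gt0 // divr_gt0 // ltr0n.
by rewrite gtr_pMl ?pi_gt0 // ltr_pdivrMr // mul1r ltr_nat.
Qed.

Lemma root_energy_Xn_sub1 (m : nat) : (0 < m)%N ->
  root_energy ('X^m - 1) = \sum_(k < m) `|cos (k%:R * (2 * pi / m%:R))|.
Proof.
move=> m0; rewrite -(factor_Xn_sub_1 (prim_root_cis m0)) big_mkord.
rewrite -(big_map (fun k : 'I_m => cis (2 * pi / m%:R) ^+ k) xpredT (fun z => 'X - z%:P)).
rewrite root_energy_prod big_map.
by apply: eq_bigr => k _; rewrite cisX.
Qed.

(** The roots of index k and N + k are opposite, so they have the same |Re z|. *)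
Lemma root_energy_double (N : nat) : (0 < N)%N ->
  root_energy ('X^(N + N) - 1) = 2 * half_cos_sum N.
Proof.
move=> N0; have NR : (N%:R : R) != 0 by rewrite pnatr_eq0 -lt0n.
have e : 2 * pi / (N + N)%:R = pi / N%:R by rewrite natrD; field; rewrite NR -natrD pnatr_eq0; lia.
rewrite root_energy_Xn_sub1 ?addn_gt0 ?N0 // e big_split_ord /= mulrDl mul1r.
congr (_ + _); apply: eq_bigr => k _.
rewrite natrD mulrDl [N%:R * _]mulrCA divff // mulr1 addrC.
by rewrite cosD cos_pi sin_pi mulr0 subr0 mulrN1 normrN.
Qed.

(** From X^(2m) - 1 = (X^m - 1)(X^m + 1); this gives the energy of X^m + 1 without listing its
    roots. *)
Lemma root_energy_sqr_sub (m : nat) : (0 < m)%N ->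
  root_energy ('X^m - 1) + root_energy ('X^m - (-1)%:P) = 2 * half_cos_sum m.
Proof.
move=> m0; rewrite -polyC1 -root_energyM ?monicXnsubC //.
rewrite -root_energy_double //; congr root_energy.
rewrite polyCN !polyC1 opprK exprD; ring.
Qed.

(** For odd [q], negation exchanges the roots of X^q - 1 and X^q + 1, so each polynomial has half of
    their joint energy. *)
Lemma root_energy_odd (q : nat) (c : C) : odd q -> c = 1 \/ c = -1 ->
  root_energy ('X^q - c%:P) = (sin (pi / (2 * q%:R)))^-1.
Proof.
move=> oq; have q0 : (0 < q)%N by rewrite odd_gt0.
have hE : half_cos_sum q = (sin (pi / (2 * q%:R)))^-1 by rewrite half_cos_sumE // oq mul1r.
have sym : root_energy ('X^q - (-1)%:P) = root_energy ('X^q - 1).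
  pose w (k : 'I_q) : C := cis (2 * pi / q%:R) ^+ k.
  have wE : \prod_(k < q) ('X - (w k)%:P) = 'X^q - 1.
    by rewrite -(factor_Xn_sub_1 (prim_root_cis q0)) big_mkord.
  have wE' : \prod_(k < q) ('X - (- w k)%:P) = 'X^q - (-1)%:P.
    have /(congr1 (fun P => P \Po - 'X)) := wE.
    rewrite rmorph_prod rmorphB rmorph1 /= comp_Xn_poly exprNn -signr_odd oq mulN1r => h.
    apply: oppr_inj; rewrite [in RHS]polyCN polyC1 opprK opprD -h.
    transitivity (\prod_(k < q) (-1 * ('X - (- w k)%:P))).
      by rewrite big_split /= prodr_const card_ord -signr_odd oq expr1 mulN1r.
    by apply: eq_bigr => k _; rewrite mulN1r rmorphB /= comp_polyX comp_polyC polyCN opprK opprD.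
  rewrite -wE' -wE -(big_map w xpredT (fun z => 'X - z%:P)).
  rewrite -(big_map (fun k => - w k) xpredT (fun z => 'X - z%:P)) !root_energy_prod !big_map.
  by apply: eq_bigr => k _; rewrite raddfN normrN.
have := root_energy_sqr_sub q0; rewrite sym hE => h.
by case=> ->; rewrite ?polyC1 ?sym; lra.
Qed.

Lemma root_energy_ge0 (P : {poly C}) : 0 <= root_energy P.
Proof. exact: sumr_ge0. Qed.

(** With p = 2N, X^p - 1 has energy 2 csc(pi/p) or 2 cot(pi/p) according to the parity of N. That of
    X^p + 1 is obtained by subtraction from 2 cot(pi/(2p)). *)
Lemma root_energy_even (p : nat) (c : C) : (0 < p)%N -> ~~ odd p -> c = 1 \/ c = -1 ->
  root_energy ('X^p - c%:P) <= 2 / sin (pi / p%:R).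
Proof.
move=> p0 ep hc; pose N := p./2.
have N0 : (0 < N)%N by rewrite /N; lia.
have pE : p = (N + N)%N by rewrite /N; lia.
have pR : (p%:R : R) != 0 by rewrite pnatr_eq0 -lt0n.
have NR : (N%:R : R) != 0 by rewrite pnatr_eq0 -lt0n.
have s0 : 0 < sin (pi / p%:R) by rewrite sin_pi_div_gt0 //; lia.
have pos : root_energy ('X^p - 1) = 2 * ((if odd N then 1 else cos (pi / p%:R)) / sin (pi / p%:R)).
  rewrite {1}pE root_energy_double // half_cos_sumE //.
  by rewrite (_ : 2 * N%:R = p%:R) // pE natrD; ring.
have cos1 : cos (pi / p%:R) <= 1 by apply/RleP; have [] := COS_bound (pi / p%:R).
have cle (x y : R) : x <= y -> 2 * (x / sin (pi / p%:R)) <= 2 * (y / sin (pi / p%:R)).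
  by move=> xy; rewrite ler_pM2l // ler_pM2r // invr_gt0.
have -> : 2 / sin (pi / p%:R) = 2 * (1 / sin (pi / p%:R)) by rewrite mul1r.
case: hc => ->; first by rewrite polyC1 pos cle //; case: ifP.
have := root_energy_sqr_sub p0; rewrite pos half_cos_sumE // (negbTE ep).
set x := pi / (2 * p%:R).
have xE : pi / p%:R = x + x by rewrite /x; field.
have sx0 : sin x != 0 by apply/lt0r_neq0; rewrite /x -natrM sin_pi_div_gt0 //; lia.
(* Half-angle formula: cot x = (1 + cos 2x) / sin 2x. Subtracting an energy of at least 2 cot(pi/p)
   then leaves at most 2 csc(pi/p). *)
have dbl : cos x / sin x = (1 + cos (pi / p%:R)) / sin (pi / p%:R).
  have cx0 : cos x != 0.
    by move: s0; rewrite xE sinD; apply: contraTneq => ->; rewrite mulr0 mul0r addr0 ltxx.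
  have -> : sin (pi / p%:R) = 2 * sin x * cos x by rewrite xE sinD; ring.
  have -> : 1 + cos (pi / p%:R) = 2 * (cos x) ^+ 2.
    rewrite xE cosD; have : sin x * sin x + cos x * cos x = 1 := sin2_cos2 x.
    by rewrite expr2; lra.
  by field; rewrite cx0.
rewrite dbl => h.
have : cos (pi / p%:R) <= (if odd N then 1 else cos (pi / p%:R)) by case: ifP.
move/cle; move: h.
set a := root_energy _; set b := (if _ then _ else _); set s := sin _ ; set c' := cos _.
by rewrite [(1 + c') / s]mulrDl; lra.
Qed.

(** * Comparison of pairs of cycles *)

Lemma half_cos_sum1 : half_cos_sum 1 = 1.
Proof. by rewrite /half_cos_sum big_ord1 mul0r cos_0 normr1. Qed.

Lemma half_cos_sum2 : half_cos_sum 2 = 1.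
Proof.
rewrite /half_cos_sum big_ord_recl big_ord1 mul0r cos_0 normr1 /= mulr1n mul1r.
by rewrite cos_pi2 normr0 addr0.
Qed.

Lemma root_energy_pos2 : root_energy ('X^2 - 1%:P) = 2.
Proof. by rewrite polyC1 (@root_energy_double 1) // half_cos_sum1 mulr1. Qed.

Lemma root_energy_neg2 : root_energy ('X^2 - (-1)%:P) = 0.
Proof.
have := @root_energy_sqr_sub 2 isT; rewrite -[in X in X + _]polyC1 root_energy_pos2 half_cos_sum2.
lra.
Qed.

Lemma IZR_le_nat (a b : nat) : (a <= b)%N -> Rle (IZR (Z.of_nat a)) (b%:R : R).
Proof. by move=> ab; rewrite -INR_IZR_INZ INRE; apply/RleP; rewrite ler_nat. Qed.

Lemma inv_sin_nat_mono (a b : nat) : (0 < a <= b)%N ->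
  (sin (pi / (2 * a%:R)))^-1 <= (sin (pi / (2 * b%:R)))^-1.
Proof.
move=> /andP[a0 ab]; apply/RleP.
have ab' : Rle (a%:R : R) b%:R by apply/RleP; rewrite ler_nat.
exact (inv_sin_div_mono _ _ (IZR_le_nat a0) ab').
Qed.

(** The negative 2-cycle has energy 0, and csc(pi/(2q)) increases with [q], whose least odd value
    here is 3. *)
Lemma cycle_pair_energy_ge (p q : nat) (c d : C) :
  (2 < q)%N -> odd q -> d = 1 \/ d = -1 ->
  root_energy ('X^2 - (-1)%:P) + root_energy ('X^3 - 1%:P) <=
  root_energy ('X^p - c%:P) + root_energy ('X^q - d%:P).
Proof.
move=> q3 oq hd; rewrite root_energy_neg2 lerD ?root_energy_ge0 //.
rewrite (root_energy_odd oq hd) (@root_energy_odd 3 1) //; last by left.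
exact: inv_sin_nat_mono.
Qed.

(** For p = 2 the odd cycle is lengthened to n - 2. For p >= 4, [inv_sin_trade] first replaces the
    lengths p, q by 2, p + q - 2. As [n] is odd, n - 2 is an odd length too. *)
Lemma cycle_pair_energy_le (n p q : nat) (c d : C) :
  (0 < p)%N -> ~~ odd p -> (2 < q)%N -> odd q -> odd n -> (p + q <= n)%N ->
  c = 1 \/ c = -1 -> d = 1 \/ d = -1 ->
  root_energy ('X^p - c%:P) + root_energy ('X^q - d%:P) <=
  root_energy ('X^2 - 1%:P) + root_energy ('X^(n - 2) - 1%:P).
Proof.
move=> p0 ep q2 oq on pqn hc hd.
rewrite root_energy_pos2 (root_energy_odd oq hd) (@root_energy_odd (n - 2) 1); [|lia|by left].
apply: le_trans (lerD (root_energy_even p0 ep hc) (lexx _)) _.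
have [p2|p4] : p = 2 \/ (4 <= p)%N by lia.
  rewrite p2 sin_pi2 divr1 lerD2l inv_sin_nat_mono //; lia.
apply: (@le_trans _ _ (2 + (sin (pi / (2 * (p + q - 2)%:R)))^-1)); last first.
  by rewrite lerD2l inv_sin_nat_mono //; lia.
have h := inv_sin_trade _ _ (IZR_le_nat p4) (IZR_le_nat q2).
have -> : (p + q - 2)%:R = p%:R + q%:R - 2 :> R by rewrite natrB ?natrD //; lia.
apply/RleP; exact h.
Qed.

(** * Energy of a sidigraph *)

Definition algRe (z : algC) : algR := in_algR (Creal_Re z).
Definition algIm (z : algC) : algR := in_algR (Creal_Im z).

(** A ring morphism compatible with real parts, so it transports the linear factors of the
    characteristic polynomial together with |Re z|. *)
Definition complex_embed (z : algC) : C :=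
  Complex (real_embed R (algRe z)) (real_embed R (algIm z)).

Lemma complex_embed_is_zmod_morphism : zmod_morphism complex_embed.
Proof.
move=> x y; rewrite /complex_embed.
have -> : algRe (x - y) = algRe x - algRe y by apply: val_inj; rewrite /= raddfB.
have -> : algIm (x - y) = algIm x - algIm y by apply: val_inj; rewrite /= raddfB.
by rewrite !rmorphB.
Qed.

Lemma complex_embed_is_monoid_morphism : monoid_morphism complex_embed.
Proof.
rewrite /complex_embed; split=> [|x y].
  have -> : algRe 1 = 1 by apply: val_inj; rewrite /= (Creal_ReP _ _) ?rpred1.
  have -> : algIm 1 = 0 by apply: val_inj; rewrite /= (Creal_ImP _ _) ?rpred1.
  by rewrite rmorph1 rmorph0.
have -> : algRe (x * y) = algRe x * algRe y - algIm x * algIm y.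
  by apply: val_inj; rewrite /= ReM.
have -> : algIm (x * y) = algRe x * algIm y + algRe y * algIm x.
  by apply: val_inj; rewrite /= ImM.
by rewrite rmorphB rmorphD !rmorphM /=; congr Complex; rewrite [X in _ + X]mulrC.
Qed.

HB.instance Definition _ :=
  GRing.isZmodMorphism.Build algC C complex_embed complex_embed_is_zmod_morphism.
HB.instance Definition _ :=
  GRing.isMonoidMorphism.Build algC C complex_embed complex_embed_is_monoid_morphism.

Definition real_energy (n : nat) (A : 'M[int]_n) : algR :=
  \sum_(z <- eigenvalues A) `|algRe z|.

Lemma energyE (n : nat) (A : 'M[int]_n) : energy A = algRval (real_energy A).
Proof. by rewrite /energy /real_energy rmorph_sum. Qed.

(** Integer coefficients are fixed by every ring morphism, so the images of the eigenvalues are the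
    roots of the same polynomial read over [C]. *)
Lemma real_embed_energy (n : nat) (A : 'M[int]_n) :
  real_embed R (real_energy A) = root_energy (map_poly intr (char_poly A)).
Proof.
rewrite rmorph_sum /=; have -> : map_poly intr (char_poly A) =
    \prod_(z <- map complex_embed (eigenvalues A)) ('X - z%:P).
  rewrite /eigenvalues; case: closed_field_poly_normal => r /= Hr.
  have -> : map_poly intr (char_poly A) =
      map_poly complex_embed (char_poly (map_mx (fun z : int => z%:~R) A)).
    rewrite -map_char_poly -map_poly_comp; apply: eq_map_poly => z /=.
    by rewrite rmorph_int.
  rewrite Hr (monicP (char_poly_monic _)) scale1r rmorph_prod big_map.
  by apply: eq_bigr => z _; rewrite rmorphB /= map_polyX map_polyC.
rewrite root_energy_prod big_map.
by apply: eq_bigr => z _; rewrite real_embed_norm.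
Qed.

Lemma ler_energy (m n : nat) (A : 'M[int]_m) (B : 'M[int]_n) :
  (energy A <= energy B) =
  (root_energy (map_poly intr (char_poly A)) <= root_energy (map_poly intr (char_poly B))).
Proof. by rewrite -!real_embed_energy ler_real_embed !energyE. Qed.

Lemma cycle_sign_unit (n : nat) (A : 'M[int]_n) (D : {set 'I_n * 'I_n}) :
  sidigraph A -> is_dcycle A D -> cycle_sign A D = 1 \/ cycle_sign A D = -1.
Proof.
move=> [sA _] [s [_ _ _ nz]]; rewrite /cycle_sign.
elim/big_ind: _ => [|x y [->|->] [->|->]|p pD]; rewrite ?mulN1r ?mul1r ?opprK; auto.
have := sA p.1 p.2; rewrite !inE (negbTE (nz p pD)) /=.
by case/orP => /eqP; auto.
Qed.

Lemma root_energy_two_cycles (n : nat) (A : 'M[int]_n) (C1 C2 : {set 'I_n * 'I_n}) :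
  sidigraph A -> exactly_two_cycles A C1 C2 ->
  [/\ root_energy (map_poly intr (char_poly A)) =
        root_energy ('X^(cycle_len C1) - ((cycle_sign A C1)%:~R)%:P) +
        root_energy ('X^(cycle_len C2) - ((cycle_sign A C2)%:~R)%:P),
      (1 < cycle_len C1)%N, (1 < cycle_len C2)%N & (cycle_len C1 + cycle_len C2 <= n)%N].
Proof.
move=> [_ A0] [_ [s1 [l1 us1 -> _]] [s2 [l2 us2 -> _]] dis all2].
have s12 i : i \in s1 -> i \notin s2.
  move=> is1; have /pred0P/(_ i)/= := dis.
  by rewrite !cycle_verts_arcs // !inE is1 /= => ->.
rewrite !cycle_len_arcs //; split=> //; last exact: size_two_cycles.
rewrite (char_poly_two_cycles us1 us2) // !rmorphM !rmorphB /= !map_polyXn !map_polyC /=.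
rewrite !root_energyM ?monicXn ?monicXnsubC ?(ltnW l1) ?(ltnW l2) //.
  by rewrite root_energyXn add0r.
by rewrite monicMl ?monicXn ?monicXnsubC ?(ltnW l1).
Qed.

Lemma intr_unit (c : int) : c = 1 \/ c = -1 -> (c%:~R : C) = 1 \/ (c%:~R : C) = -1.
Proof. by case=> ->; [left | right]; rewrite ?mulrNz. Qed.

(** * The two extremal bounds *)

Lemma energy_le_max (n : nat) (S T : 'M[int]_n) : odd n ->
  Dns_even_odd S -> Dns_with T 2 1 (n - 2) 1 -> energy S <= energy T.
Proof.
move=> on [[sS _ _] [C1 [C2 [twoS e1 o2]]]] [[sT _ _] [D1 [D2 [twoT l1 g1 l2 g2]]]].
have [eS p1 q1 pq] := root_energy_two_cycles sS twoS.
have [eT _ _ _] := root_energy_two_cycles sT twoT.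
have [_ dC1 dC2 _ _] := twoS.
rewrite ler_energy eS eT l1 g1 l2 g2.
(* The odd cycle has length greater than 1, hence at least 3. *)
apply: cycle_pair_energy_le => //; try exact/intr_unit/cycle_sign_unit; lia.
Qed.

Lemma energy_ge_min (n : nat) (S T : 'M[int]_n) :
  Dns_even_odd S -> Dns_with T 2 (-1) 3 1 -> energy T <= energy S.
Proof.
move=> [[sS _ _] [C1 [C2 [twoS e1 o2]]]] [[sT _ _] [D1 [D2 [twoT l1 g1 l2 g2]]]].
have [eS p1 q1 pq] := root_energy_two_cycles sS twoS.
have [eT _ _ _] := root_energy_two_cycles sT twoT.
have [_ dC1 dC2 _ _] := twoS.
rewrite ler_energy eS eT l1 g1 l2 g2 mulrNz.
apply: cycle_pair_energy_ge => //; last exact/intr_unit/cycle_sign_unit; lia.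
Qed.

Theorem theorem3p27 (n : nat) : (5 < n)%N ->
  (* (i) maximum, for n odd: attained by D_n^s[2, n-2] *)
  (odd n ->
     (exists T : 'M[int]_n, Dns_with T 2 1 (n - 2) 1) /\
     (forall S T : 'M[int]_n, Dns_even_odd S -> Dns_with T 2 1 (n - 2) 1 ->
        energy S <= energy T)) /\
  (* (ii) minimum: attained by D_n^s[bold 2, 3] *)
  ((exists T : 'M[int]_n, Dns_with T 2 (-1) 3 1) /\
   (forall S T : 'M[int]_n, Dns_even_odd S -> Dns_with T 2 (-1) 3 1 ->
        energy T <= energy S)).
Proof.
move=> n5; split=> [on|].
  split; last by move=> S T; apply: energy_le_max.
  have q1 : (1 < n - 2)%N by lia.
  have qn : ((n - 2).+2 <= n)%N by lia.
  by exists (witness 1 qn); apply: witness_Dns_with => //; left.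
split; last by move=> S T; apply: energy_ge_min.
have qn : (5 <= n)%N by apply: ltnW.
by exists (@witness n 3 (-1) qn); apply: witness_Dns_with => //; right.
Qed.
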